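(* Let $Z$ be a non-empty set, $F$ a correspondence from $Z$ to $Z$ with non-empty values, and $r$ a mapping from $Z$ to $[0,1]$. Assume that the set $W=\{w_{m,n} : m\geq 0, n\geq 1\}$, endowed with the uniform distance $d_\infty$, is a precompact metric space. Then for every initial state $z$ in $Z$, the problem $\Gamma(z)=(Z,F,r,z)$ has a uniform value, which is $$v^*(z)=\underline{v}(z)=v^+(z)=v^-(z)=\sup_{m\geq 0}\inf_{n\geq 1}v_{m,n}(z)=\sup_{m\geq 0}\inf_{n\geq 1}w_{m,n}(z).$$ Moreover, the sequence of functions $(v_n)_{n\geq 1}$ converges uniformly on $Z$ to $v^*$.
   Context: A correspondence $F$ from $Z$ to $Z$ assigns to each $z\in Z$ a subset $F(z)\subseteq Z$. For $z_0\in Z$, a play at $z_0$ is a sequence $s=(z_1,z_2,\dots)\in Z^\infty$ with $z_t\in F(z_{t-1})$ for all $t\geq 1$; $S(z_0)$ is the set of plays at $z_0$. For a play $s=(z_t)_{t\geq 1}$, $m\geq 0$, $n\geq 1$: $\gamma_n(s)=\frac1n\sum_{t=1}^n r(z_t)$, $\gamma_{m,n}(s)=\frac1n\sum_{t=1}^n r(z_{m+t})$, $\nu_{m,n}(s)=\min\{\gamma_{m,t}(s): t\in\{1,\dots,n\}\}$. For $z\in Z$: $v_n(z)=\sup_{s\in S(z)}\gamma_n(s)$, $v_{m,n}(z)=\sup_{s\in S(z)}\gamma_{m,n}(s)$, $w_{m,n}(z)=\sup_{s\in S(z)}\nu_{m,n}(s)$; $v^-(z)=\liminf_n v_n(z)$,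 $v^+(z)=\limsup_n v_n(z)$, $\underline v(z)=\sup_{s\in S(z)}\left(\liminf_n\gamma_n(s)\right)$; and $v^*(z)=\inf_{n\geq1}\sup_{m\geq0}w_{m,n}(z)=\inf_{n\geq1}\sup_{m\geq0}v_{m,n}(z)$ (the two expressions are always equal). $\Gamma(z)$ has a uniform value if $\underline v(z)=v^+(z)$; the uniform value is then this common number. The uniform distance is $d_\infty(w,w')=\sup_{z\in Z}|w(z)-w'(z)|$. Precompact means totally bounded: for every $\varepsilon>0$ the space is covered by finitely many balls of radius $\varepsilon$. *)

(* Defs.v *)
From HB Require Import structures.
From mathcomp Require Import all_boot all_order all_algebra.
From mathcomp Require Import all_classical all_reals all_analysis.

Set Implicit Arguments.
Unset Strict Implicit.
Unset Printing Implicit Defensive.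

Import Order.TTheory GRing.Theory Num.Theory.
Import numFieldNormedType.Exports.

Local Open Scope classical_set_scope.
Local Open Scope ring_scope.

(* All suprema and infima below are taken in R, where [sup] and [inf] return 0
   on sets that are empty or unbounded. They have their usual meaning when [F]
   has non-empty values and [r] takes values in [0, 1]. *)

(* A sequence (z_1, z_2, ...) is encoded as [s : nat -> Z] with [s t] standing
   for z_(t+1); the initial state z_0 is not part of the play. *)
Definition plays (Z : Type) (F : Z -> set Z) (z0 : Z) : set (nat -> Z) :=
  [set s | F z0 (s 0%N) /\ forall t, F (s t) (s t.+1)].

Section dynamic_programming.
Variables (R : realType) (Z : Type) (F : Z -> set Z) (r : Z -> R).

(* The averages have junk value 0 at n = 0. This affects neither limits in n
   nor the infima in n, which are restricted to n >= 1. *)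
Definition gamma (n : nat) (s : nat -> Z) : R :=
  n%:R^-1 * \sum_(0 <= t < n) r (s t).

Definition gamma_shift (m n : nat) (s : nat -> Z) : R :=
  n%:R^-1 * \sum_(0 <= t < n) r (s (m + t)%N).

(* For n >= 1, the default value is one of the terms of the minimum. *)
Definition nu (m n : nat) (s : nat -> Z) : R :=
  \big[Num.min/gamma_shift m 1 s]_(1 <= t < n.+1) gamma_shift m t s.

Definition v_n (n : nat) (z : Z) : R :=
  sup [set gamma n s | s in plays F z].

Definition v_mn (m n : nat) (z : Z) : R :=
  sup [set gamma_shift m n s | s in plays F z].

Definition w_mn (m n : nat) (z : Z) : R :=
  sup [set nu m n s | s in plays F z].

Definition v_minus (z : Z) : R := limn_inf (fun n => v_n n z).

Definition v_plus (z : Z) : R := limn_sup (fun n => v_n n z).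

Definition v_low (z : Z) : R :=
  sup [set limn_inf (fun n => gamma n s) | s in plays F z].

Definition v_star (z : Z) : R :=
  inf [set sup [set w_mn m n z | m in [set: nat]] | n in [set n | (1 <= n)%N]].

Definition has_uniform_value (z : Z) : Prop := v_low z = v_plus z.

Definition is_uniform_value (z : Z) (u : R) : Prop :=
  v_low z = u /\ v_plus z = u.

Definition W_set : set (Z -> R) :=
  [set f | exists m n : nat, (1 <= n)%N /\ f = w_mn m n].

End dynamic_programming.

Definition d_infty (R : realType) (Z : Type) (f g : Z -> R) : R :=
  sup [set `|f z - g z| | z in [set: Z]].

(* Precompactness of the metric space [(A, d)]: the centers of the balls lie
   in [A]. The library's [precompact] is instead relative compactness in an
   ambient topological space. *)
Definition totally_bounded (R : realType) (T : Type) (d : T -> T -> R)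
    (A : set T) : Prop :=
  forall e : R, 0 < e -> exists C : set T,
    [/\ finite_set C, C `<=` A & A `<=` \bigcup_(c in C) [set x | d c x < e]].

(* [{classic Z}] is [Z] itself, with the choice structure that the library
   requires on the domain of functions with the uniform topology. *)
Definition converges_uniformly (R : realType) (Z : Type)
    (u : nat -> Z -> R) (f : Z -> R) : Prop :=
  {uniform, (u : nat -> {classic Z} -> R) @ \oo --> (f : {classic Z} -> R)}.

(* Main.v *)
Require Import Defs.
From HB Require Import structures.
From mathcomp Require Import all_boot all_order all_algebra.
From mathcomp Require Import all_classical all_reals all_analysis.
From mathcomp Require Import ring lra.

Set Implicit Arguments.
Unset Strict Implicit.
Unset Printing Implicit Defensive.

Import Order.TTheory GRing.Theory Num.Theory.
Import numFieldNormedType.Exports.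

Local Open Scope classical_set_scope.
Local Open Scope ring_scope.

(** Let [V] be [v_star]. A play that averages [a] on a long horizon has, by
    cutting the horizon into blocks, a stage from which all averages of length
    at most [k] are at least [a], up to a small error ([payoff_le_blocks]).
    Hence the values [v_mn m n] are bounded by the suprema over [m] of the
    [w_mn m k], up to [k / n], and the upper bounds by [V] need only that these
    suprema come down to [V].

    The lower bounds need compactness. Total boundedness of the functions
    [w_mn m n] splits [Z] into finitely many cells on which all of them are
    constant up to [e] ([totally_bounded_cells]). This has three consequences.
    - From a given state, every cell that can be visited at all is visited
      before a bounded stage. Since [w_mn m n z] is the supremum of [w_mn 0 n]
      over the states reachable from [z] at stage [m], bounded delays [m] are as
      good as arbitrary ones, with a bound uniform in the state
      ([w_reach_early_unif]). As [w_mn m n] decreases with [n], a pigeonhole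
      argument gives one delay [m <= M] good for all horizons [n]:
      [w_mn m n z >= V z - e] ([V_guaranteed]).
    - The convergence of the suprema over [m] of [w_mn m n] to [V] is uniform
      ([w_le_V_unif]).
    - Together these bounds give the uniform convergence of [v_n] to [V]
      ([v_cvg_unif]), and the equality of [V] with both sup-inf expressions.

    The remaining point is that a single play achieves [V z - e] in the long
    run ([good_play]). From each state a delay [m <= M] leads to a stretch of
    any prescribed length [n] whose averages, counted from its start, are all at
    least [V - e'], and after which [V] has decreased by at most [e']
    ([good_block]). Such blocks are
    concatenated with errors [d / 2], [d / 4], [d / 8] and so on, so that the
    total loss on [V] is at most [d]. The delay bound [M] may grow from block to
    block, but each stretch is chosen so long that it pays for the delay of the
    next block. *)

(** * Suprema, infima and lower limits of functions into [0, 1] *)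

Section unit_interval.
Variables (R : realType) (T : Type) (f : T -> R).
Hypothesis f01 : forall x, 0 <= f x <= 1.

(** On sets of reals that are empty or unbounded [sup] and [inf] are [0]. For
    functions with values in [0, 1] only the emptiness of [A] can matter. *)
Lemma image01_ub (A : set T) : has_ubound [set f x | x in A].
Proof. by exists 1 => _ [x _ <-]; case/andP: (f01 x). Qed.

Lemma image01_lb (A : set T) : has_lbound [set f x | x in A].
Proof. by exists 0 => _ [x _ <-]; case/andP: (f01 x). Qed.

Lemma le_sup01 (A : set T) x : A x -> f x <= sup [set f x | x in A].
Proof. by move=> Ax; apply: (ub_le_sup (image01_ub A)); exists x. Qed.

Lemma ge_inf01 (A : set T) x : A x -> inf [set f x | x in A] <= f x.
Proof. by move=> Ax; apply: (ge_inf (image01_lb A)); exists x. Qed.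

Lemma sup01_le (A : set T) c : A !=set0 -> (forall x, A x -> f x <= c) ->
  sup [set f x | x in A] <= c.
Proof.
move=> A0 fc; apply: ge_sup; first exact: image_nonempty.
by move=> _ [x Ax <-]; apply: fc.
Qed.

Lemma inf01_ge (A : set T) c : A !=set0 -> (forall x, A x -> c <= f x) ->
  c <= inf [set f x | x in A].
Proof.
move=> A0 fc; apply: lb_le_inf; first exact: image_nonempty.
by move=> _ [x Ax <-]; apply: fc.
Qed.

Lemma sup01_near (A : set T) e : A !=set0 -> 0 < e ->
  exists2 x, A x & sup [set f x | x in A] - e <= f x.
Proof.
move=> A0 e0.
have [|_ [x Ax <-] /ltW lt] := sup_adherent e0 (E := [set f x | x in A]).
  by split; [exact: image_nonempty | exact: image01_ub].
by exists x.
Qed.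

Lemma sup01_in (A : set T) : A !=set0 -> 0 <= sup [set f x | x in A] <= 1.
Proof.
move=> A0; apply/andP; split; last first.
  by apply: sup01_le => // x _; case/andP: (f01 x).
case: A0 => x Ax; apply: le_trans (le_sup01 Ax).
by case/andP: (f01 x).
Qed.

Lemma inf01_in (A : set T) : A !=set0 -> 0 <= inf [set f x | x in A] <= 1.
Proof.
move=> A0; apply/andP; split.
  by apply: inf01_ge => // x _; case/andP: (f01 x).
case: A0 => x Ax; apply: (le_trans (ge_inf01 Ax)).
by case/andP: (f01 x).
Qed.

End unit_interval.

Section liminf01.
Variables (R : realType) (u : nat -> R).
Hypothesis u01 : forall n, 0 <= u n <= 1.

Lemma limn_inf01E :
  limn_inf u = sup [set inf [set u k | k in [set k | (n <= k)%N]] | n in setT].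
Proof.
rewrite limn_infE //; exists 1; split; first exact: num_real.
move=> x x1 n _ /=; case/andP: (u01 n) => u0 u1.
by rewrite ger0_norm // (le_trans u1) // ltW.
Qed.

Let tail0 n : [set k | (n <= k)%N] !=set0.
Proof. by exists n => /=. Qed.

Lemma limn_inf_ge c (N : nat) : (forall n, (N <= n)%N -> c <= u n) ->
  c <= limn_inf u.
Proof.
move=> uc; rewrite limn_inf01E.
apply: le_trans (le_sup01 (A := setT) (x := N)
  (fun n => inf01_in u01 (tail0 n)) I).
by apply: inf01_ge (tail0 N) _ => // n /= /uc.
Qed.

Lemma limn_inf_le c : (forall N, exists2 n, (N <= n)%N & u n <= c) ->
  limn_inf u <= c.
Proof.
move=> uc; rewrite limn_inf01E.
apply: sup01_le => [|N _]; first by exists 0%N.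
have [n Nn un] := uc N.
exact: le_trans (ge_inf01 u01 (x := n) Nn) un.
Qed.

Lemma limn_inf01_in : 0 <= limn_inf u <= 1.
Proof.
rewrite limn_inf01E; apply: (sup01_in (fun n => inf01_in u01 (tail0 n))).
by exists 0%N.
Qed.

End liminf01.

Lemma exists_natr_ge (R : realType) (x : R) : exists n : nat, x <= n.+1%:R.
Proof.
exists (Num.bound `|x|); apply: le_trans (ler_norm x) _.
by apply/ltW/(lt_trans (archi_boundP (normr_ge0 x))); rewrite ltr_nat.
Qed.

(** * Total boundedness and uniform convergence *)

(** Two points lie in the same cell when each function of a finite [e / 3]-net
    of [W] takes at both of them values in the same interval of length at most
    [e / 3]; a cell is thus encoded by a finite function. *)
Lemma totally_bounded_cells (R : realType) (Z : Type) (W : set (Z -> R)) :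
  [set: Z] !=set0 ->
  (forall f, W f -> forall z, 0 <= f z <= 1) ->
  totally_bounded (@d_infty R Z) W ->
  forall e, 0 < e -> exists (T : finType) (rep : T -> Z),
    forall z, exists i, forall f, W f -> `|f z - f (rep i)| <= e.
Proof.
move=> [z0 _] W01 tbW e e0; have e30 : 0 < e / 3 by lra.
have [C [/finite_seqP[cs ->] CW Wnet]] := tbW _ e30.
(* The unit interval is cut into intervals of length [1 / N <= e / 3]. *)
have [N0 N0P] := exists_natr_ge (e / 3)^-1; set N := N0.+1 in N0P.
have Ngt0 : 0 < N%:R :> R by rewrite ltr0n.
clearbody N.
pose cell z : {ffun 'I_(size cs) -> 'I_N.+1} :=
  [ffun i => inord (Num.trunc (N%:R * nth (fun=> 0) cs (val i) z))].
have /choice[rep repP] : forall t, exists z, forall z',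
    cell z' = t -> cell z = t.
  move=> t; have [[z zt]|no] := pselect (exists z, cell z = t).
    by exists z.
  by exists z0 => z' zt'; case: no; exists z'.
exists {ffun 'I_(size cs) -> 'I_N.+1}, rep => z.
exists (cell z) => f Wf; set z' := rep _.
have zz' : cell z' = cell z by apply: (repP _ z).
have [c /= ccs dcf] := Wnet f Wf.
have c01 := W01 c (CW c ccs); have f01 := W01 f Wf.
have near_c x : `|c x - f x| <= e / 3.
  apply: le_trans (ltW dcf).
  apply: (le_sup01 (f := fun z => `|c z - f z|)) => // y.
  rewrite normr_ge0 /=; have := c01 y; have := f01 y.
  by move=> /andP[? ?] /andP[? ?]; apply/ler_normlP; split; lra.
have cz x : (Num.trunc (N%:R * c x))%:R <= N%:R * c x <
    (Num.trunc (N%:R * c x)).+1%:R.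
  by apply: truncn_itv; rewrite mulr_ge0 //; case/andP: (c01 x).
have ci : (index c cs < size cs)%N by rewrite index_mem.
have tr x : cell x (Ordinal ci) = Num.trunc (N%:R * c x) :> nat.
  rewrite ffunE /= nth_index // inordK // ltnS -(ler_nat R).
  case/andP: (cz x) => /le_trans + _; apply.
  by case/andP: (c01 x) => _ c1; rewrite -[leRHS]mulr1 ler_wpM2l.
have ccz : `|c z - c z'| <= e / 3.
  have N1 : 1 <= N%:R * (e / 3) by rewrite -ler_pdivrMr // div1r.
  have := cz z; have := cz z'; rewrite -!tr zz' -natr1 => /andP[? ?] /andP[? ?].
  by apply/ler_normlP; split; rewrite -(ler_pM2l Ngt0); lra.
have /ler_normlP[? ?] := near_c z; have /ler_normlP[? ?] := near_c z'.
by move: ccz => /ler_normlP[? ?]; apply/ler_normlP; split; lra.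
Qed.

Lemma converges_uniformlyI (R : realType) (Z : Type) (u : nat -> Z -> R)
    (f : Z -> R) :
  (forall e, 0 < e -> exists N, forall n, (N <= n)%N ->
    forall z, `|f z - u n z| <= e) ->
  converges_uniformly u f.
Proof.
move=> uf; move=> P /uniform_nbhs[E [+ EP]].
rewrite -entourage_from_ballE => -[e /= e0 eE].
have e20 : 0 < e / 2 by lra.
have [N NP] := uf _ e20; exists N => // n /= Nn; apply: EP => z _.
by apply: eE; apply: le_lt_trans (NP n Nn z) _; lra.
Qed.

(** * Plays: shifting, splicing, limits *)

Section plays.
Variables (Z : Type) (F : Z -> set Z).

(** Plays do not record their initial state, so that [s t] is the state at stage
    [t.+1]; [state z s] restores the stage numbering by putting [z] at stage
    [0]. *)
Definition state (z : Z) (s : nat -> Z) (t : nat) : Z :=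
  if t is t'.+1 then s t' else z.

Definition splice (m : nat) (s s' : nat -> Z) (t : nat) : Z :=
  if (t < m)%N then s t else s' (t - m)%N.

Lemma playsP z s : plays F z s <-> forall t, F (state z s t) (s t).
Proof.
split=> [[s0 sS]|sF]; first by case.
by split=> [|t]; [exact: (sF 0%N) | exact: (sF t.+1)].
Qed.

Lemma plays_shift z s m : plays F z s ->
  plays F (state z s m) (fun t => s (m + t)%N).
Proof.
move=> /playsP sF; apply/playsP => -[|t] /=.
  by rewrite addn0.
by rewrite addnS; exact: (sF (m + t).+1).
Qed.

Lemma spliceD m s s' t : splice m s s' (m + t) = s' t.
Proof. by rewrite /splice ltnNge leq_addr /= addKn. Qed.

Lemma splice_lt m s s' t : (t < m)%N -> splice m s s' t = s t.
Proof. by rewrite /splice => ->. Qed.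

Lemma state_spliceD z m s s' t :
  state z (splice m s s') (m + t) = state (state z s m) s' t.
Proof.
case: t => [|t]; last by rewrite addnS /= spliceD.
by rewrite addn0; case: m => //= m; rewrite splice_lt.
Qed.

Lemma state_splice_le z m s s' t : (t <= m)%N ->
  state z (splice m s s') t = state z s t.
Proof. by case: t => //= t tm; rewrite splice_lt. Qed.

Lemma plays_splice z m s s' : plays F z s -> plays F (state z s m) s' ->
  plays F z (splice m s s').
Proof.
move=> /playsP sF /playsP s'F; apply/playsP => t.
case: (ltnP t m) => tm.
  by rewrite splice_lt // state_splice_le // ltnW.
by rewrite -(subnKC tm) spliceD state_spliceD.
Qed.

Lemma plays_nonempty : (forall z, F z !=set0) -> forall z, plays F z !=set0.
Proof.
move=> /choice [f fF] z; exists (fun t => iter t.+1 f z).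
by split=> [|t] /=; exact: fF.
Qed.

End plays.

(** A form of dependent choice for plays that are built block by block, with an
    invariant that changes from one block to the next. *)
Lemma exists_seq (X : Type) (P : nat -> X -> Prop) (Q : X -> X -> Prop) :
  (exists x, P 0%N x) ->
  (forall i x, P i x -> exists y, P i.+1 y /\ Q x y) ->
  exists x : nat -> X, forall i, P i (x i) /\ Q (x i) (x i.+1).
Proof.
move=> [x0 Px0] step.
have [|f [f0 fP]] := @dependent_choice {ix : nat * X | P ix.1 ix.2}
    (fun a b => (sval b).1 = (sval a).1.+1 /\ Q (sval a).2 (sval b).2) _
    (exist _ (0%N, x0) Px0).
  move=> [[i x] /= Px]; apply: cid; have [y [Py Qxy]] := step i x Px.
  by exists (exist _ (i.+1, y) Py).
have fi i : (sval (f i)).1 = i.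
  by elim: i => [|i IH]; [rewrite f0 | rewrite (fP i).1 IH].
exists (fun i => (sval (f i)).2) => i; split; last exact: (fP i).2.
by have := svalP (f i); rewrite fi.
Qed.

(** The limit of plays that extend each other's prefixes: coordinate [t] is
    settled from the play of index [t.+1] on, whose prefix has length at least
    [t.+1]. *)
Lemma limit_play (Z : Type) (F : Z -> set Z) z (L : nat -> nat)
    (s : nat -> nat -> Z) :
  (forall i, plays F z (s i)) -> (forall i, (L i < L i.+1)%N) ->
  (forall i t, (t < L i)%N -> s i.+1 t = s i t) ->
  exists s', plays F z s' /\ forall i t, (t < L i)%N -> s' t = s i t.
Proof.
move=> Ss Llt sE.
have leL i : (i <= L i)%N by elim: i => // i IH; exact: leq_ltn_trans (Llt i).
have homoL i j : (i <= j)%N -> (L i <= L j)%N.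
  by move/subnKC <-; elim: (j - i)%N => [|k IH]; rewrite ?addn0 // addnS
    (leq_trans IH) // ltnW.
have sE' i j t : (i <= j)%N -> (t < L i)%N -> s j t = s i t.
  move=> /subnKC <- tL; elim: (j - i)%N => [|k IH]; first by rewrite addn0.
  by rewrite addnS sE // (leq_trans tL) // homoL // leq_addr.
pose s' t := s t.+1 t.
have s'E i t : (t < L i)%N -> s' t = s i t.
  move=> tL; case: (leqP i t.+1) => [it|/ltnW ti]; first exact: sE'.
  by rewrite [RHS](sE' _ _ _ ti).
exists s'; split=> //; apply/playsP => t.
have -> : state z s' t = state z (s t.+1) t.
  by case: t => //= t; apply: s'E; exact: leq_trans (leL _).
by have /playsP := Ss t.+1; apply.
Qed.

(** * Payoffs and values *)

Section values.
Variables (R : realType) (Z : Type) (F : Z -> set Z) (r : Z -> R).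
Hypothesis F_nonempty : forall z, F z !=set0.
Hypothesis r01 : forall z, 0 <= r z <= 1.

Local Notation w := (w_mn F r).
Local Notation v := (v_mn F r).
Local Notation V := (v_star F r).
Local Notation S := (plays F).

Lemma plays_n0 z : S z !=set0. Proof. exact: plays_nonempty. Qed.

(** Averages are handled through the sums [payoff], which are additive in the
    horizon and need no division. *)
Definition payoff (m n : nat) (s : nat -> Z) : R :=
  \sum_(0 <= t < n) r (s (m + t)%N).

Lemma payoffD m n k s : payoff m (n + k) s = payoff m n s + payoff (m + n) k s.
Proof.
rewrite /payoff (big_cat_nat (n := n)) ?leq_addr //=; congr (_ + _).
have := big_addn 0 (n + k) n predT (fun t => r (s (m + t)%N)).
rewrite add0n addKn => ->.
by apply: eq_bigr => i _; rewrite -addnA (addnC n).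
Qed.

Lemma eq_payoff m n s m' s' :
  (forall t, (t < n)%N -> s (m + t)%N = s' (m' + t)%N) ->
  payoff m n s = payoff m' n s'.
Proof. by move=> ss; apply: eq_big_nat => t /andP[_ tn]; rewrite ss. Qed.

Lemma payoff_shift m k n s :
  payoff k n (fun t => s (m + t)%N) = payoff (m + k) n s.
Proof. by apply: eq_payoff => t _; rewrite addnA. Qed.

Lemma payoff_ge0 m n s : 0 <= payoff m n s.
Proof. by apply: sumr_ge0 => t _; case/andP: (r01 (s (m + t)%N)). Qed.

Lemma payoff_le m n s : payoff m n s <= n%:R.
Proof.
apply: le_trans (_ : \sum_(0 <= t < n) 1 <= _).
  by apply: ler_sum => t _; case/andP: (r01 (s (m + t)%N)).
by rewrite sumr_const_nat subn0.
Qed.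

Lemma gamma_shift_ge m n s c : (0 < n)%N ->
  (c <= gamma_shift r m n s) = (n%:R * c <= payoff m n s).
Proof. by move=> n0; rewrite ler_pdivlMl // ltr0n. Qed.

Lemma gamma_shift_le m n s c : (0 < n)%N ->
  (gamma_shift r m n s <= c) = (payoff m n s <= n%:R * c).
Proof. by move=> n0; rewrite ler_pdivrMl // ltr0n. Qed.

Lemma gamma_shift01 m n s : 0 <= gamma_shift r m n s <= 1.
Proof.
case: n => [|n]; first by rewrite /gamma_shift invr0 mul0r lexx ler01.
by rewrite gamma_shift_ge // gamma_shift_le // mulr0 mulr1 payoff_ge0 payoff_le.
Qed.

(** Including [t = 0], where the inequality is [0 <= 0], spares the
    users of the equivalence a case distinction. *)
Lemma nu_ge m n s c : (0 < n)%N ->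
  (forall t, (t <= n)%N -> t%:R * c <= payoff m t s) <-> c <= nu r m n s.
Proof.
move=> n0; split=> [pc|cnu t tn].
  rewrite /nu big_nat_cond; apply: le_bigmin.
    by rewrite gamma_shift_ge // pc.
  by move=> t; rewrite andbT => /andP[t0 tn]; rewrite gamma_shift_ge // pc.
case: t tn => [|t] tn; first by rewrite mul0r payoff_ge0.
rewrite -gamma_shift_ge //; apply: le_trans cnu _.
by rewrite /nu; apply: ge_bigmin_seq => //; rewrite mem_index_iota /= ltnS.
Qed.

Lemma nu_attained m n s : (0 < n)%N ->
  exists t, [/\ (0 < t)%N, (t <= n)%N & payoff m t s <= t%:R * nu r m n s].
Proof.
move=> n0; apply: contrapT => /forallNP no.
have gt t : (0 < t <= n)%N -> nu r m n s < gamma_shift r m t s.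
  case/andP=> t0 tn; rewrite ltNge; apply/negP.
  by rewrite gamma_shift_le // => le; apply: (no t).
suff: nu r m n s < nu r m n s by rewrite ltxx.
rewrite {2}/nu big_nat_cond; apply: lt_bigmin; first exact: gt.
by move=> t; rewrite andbT => /gt.
Qed.

Lemma nu01 m n s : (0 < n)%N -> 0 <= nu r m n s <= 1.
Proof.
move=> n0; apply/andP; split.
  by apply/nu_ge => // t _; rewrite mulr0 payoff_ge0.
have /nu_ge /(_ 1%N) := lexx (nu r m n s).
by move=> /(_ n0 n0); rewrite mul1r => /le_trans; apply; exact: payoff_le.
Qed.

Lemma nu_anti m n n' s : (0 < n)%N -> (n <= n')%N -> nu r m n' s <= nu r m n s.
Proof.
move=> n0 nn'; apply/nu_ge => // t tn.
have /nu_ge := lexx (nu r m n' s); apply; last exact: leq_trans nn'.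
exact: leq_trans nn'.
Qed.

Lemma nu_shift m k n s : nu r k n (fun t => s (m + t)%N) = nu r (m + k) n s.
Proof.
have E t : gamma_shift r k t (fun t => s (m + t)%N) = gamma_shift r (m + k) t s.
  by rewrite /gamma_shift; congr (_ * _); exact: payoff_shift.
by rewrite /nu E; apply: eq_bigr.
Qed.

Lemma w01 m n z : (0 < n)%N -> 0 <= w m n z <= 1.
Proof. by move=> n0; apply: sup01_in (plays_n0 z) => s; exact: nu01. Qed.

Lemma nu_le_w m n z s : (0 < n)%N -> S z s -> nu r m n s <= w m n z.
Proof. by move=> n0 Ss; apply: (le_sup01 (fun s => nu01 m s n0) Ss). Qed.

Lemma w_le m n z c : (0 < n)%N -> (forall s, S z s -> nu r m n s <= c) ->
  w m n z <= c.
Proof. by move=> n0; apply: sup01_le (plays_n0 z) => s; exact: nu01. Qed.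

Lemma w_near m n z e : (0 < n)%N -> 0 < e ->
  exists2 s, S z s & w m n z - e <= nu r m n s.
Proof. by move=> n0; apply: sup01_near (plays_n0 z) => s; exact: nu01. Qed.

Lemma w_anti m n n' z : (0 < n)%N -> (n <= n')%N -> w m n' z <= w m n z.
Proof.
move=> n0 nn'; apply: w_le; first exact: leq_trans nn'.
by move=> s Ss; apply: le_trans (nu_anti _ _ n0 nn') (nu_le_w _ n0 Ss).
Qed.

Lemma v01 m n z : 0 <= v m n z <= 1.
Proof. by apply: sup01_in (plays_n0 z) => s; exact: gamma_shift01. Qed.

Lemma gamma_le_v m n z s : S z s -> gamma_shift r m n s <= v m n z.
Proof.
by move=> Ss; apply: (le_sup01 (gamma_shift01 m n) Ss).
Qed.

Lemma v_le m n z c : (forall s, S z s -> gamma_shift r m n s <= c) ->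
  v m n z <= c.
Proof. by apply: sup01_le (plays_n0 z) => s; exact: gamma_shift01. Qed.

Lemma payoff_le_v m n z s : S z s -> payoff m n s <= n%:R * v m n z.
Proof.
case: n => [|n] Ss; first by rewrite mul0r; exact: payoff_le.
by rewrite -gamma_shift_le // gamma_le_v.
Qed.

Lemma w_le_v m n z : (0 < n)%N -> w m n z <= v m n z.
Proof.
move=> n0; apply: w_le => // s Ss; apply: le_trans (gamma_le_v m n Ss).
by rewrite gamma_shift_ge //; have /nu_ge := lexx (nu r m n s); apply.
Qed.

(** The next three lemmas are all that is used of the definition of [v_star] as
    an infimum of suprema. *)
Lemma V_ge z c :
  (forall n, (0 < n)%N -> exists m, c <= w m n z) -> c <= V z.
Proof.
move=> wc; apply: lb_le_inf; first by apply: image_nonempty; exists 1%N.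
move=> _ [n n0 <-]; have [m cw] := wc n n0; apply: le_trans cw _.
by apply: (le_sup01 (fun m => w01 m z n0) (A := setT)).
Qed.

Lemma V_near_ge z e n : 0 < e -> (0 < n)%N -> exists m, V z - e <= w m n z.
Proof.
move=> e0 n0.
have [||m _ le] := @sup01_near _ _ (fun m => w m n z) _ setT _ _ e0.
- by move=> m; exact: w01.
- by exists 0%N.
exists m; apply: le_trans le; rewrite lerD2r; apply: ge_inf; last by exists n.
exists 0 => _ [k k0 <-]; apply: (@le_trans _ _ (w 0 k z)).
  by case/andP: (w01 0 z k0).
by apply: (le_sup01 (fun m => w01 m z k0) (A := setT)).
Qed.

Lemma V_near_le z e : 0 < e ->
  exists2 n, (0 < n)%N & forall m, w m n z <= V z + e.
Proof.
move=> e0.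
have [|_ [n n0 <-] /ltW le] := @inf_adherent _
  [set sup [set w m n z | m in setT] | n in [set n | (1 <= n)%N]] _ e0.
  split; first by apply: image_nonempty; exists 1%N.
  exists 0 => _ [k k0 <-]; apply: (@le_trans _ _ (w 0 k z)).
    by case/andP: (w01 0 z k0).
  by apply: (le_sup01 (fun m => w01 m z k0) (A := setT)).
exists n => // m; apply: le_trans le.
by apply: (le_sup01 (fun m => w01 m z n0) (A := setT)).
Qed.

Lemma V01 z : 0 <= V z <= 1.
Proof.
apply/andP; split.
  by apply: V_ge => n n0; exists 0%N; case/andP: (w01 0 z n0).
apply/ler_addgt0Pr => e e0; have [m le] := V_near_ge z e0 (ltn0Sn 0).
by rewrite -lerBlDr (le_trans le) //; case/andP: (w01 m z (ltn0Sn 0)).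
Qed.

(** From any stage, the minimum defining [nu] is attained by a block of at most
    [k] stages of average at most [c]. Such blocks are cut off one after the
    other, until at most [k] stages remain, which weigh at most [k]. *)
Lemma payoff_le_blocks k c s m n : (0 < k)%N -> (forall l, nu r l k s <= c) ->
  payoff m n s <= n%:R * c + k%:R.
Proof.
move=> k0 nuc; elim/ltn_ind: n m => n IH m.
have c0 : 0 <= c by apply: le_trans (nuc 0%N); case/andP: (nu01 0 s k0).
have [nk|kn] := leqP n k.
  apply: le_trans (payoff_le m n s) _.
  by rewrite -[leLHS]add0r lerD ?mulr_ge0 // ler_nat.
have [t [t0 tk pt]] := nu_attained m s k0.
have tn : (t <= n)%N by rewrite (leq_trans tk) // ltnW.
rewrite -(subnKC tn) payoffD natrD mulrDl -addrA lerD //.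
  by apply: le_trans pt _; rewrite ler_wpM2l.
by apply: IH; rewrite ltn_subrL t0 (leq_trans t0).
Qed.

Lemma v_le_blocks k c z m n : (0 < k)%N -> (forall l, w l k z <= c) ->
  n%:R * v m n z <= n%:R * c + k%:R.
Proof.
move=> k0 wc; case: n => [|n]; first by rewrite !mul0r add0r.
rewrite -ler_pdivlMl ?ltr0n //; apply: v_le => s Ss.
rewrite gamma_shift_le // mulrA divff ?pnatr_eq0 // mul1r.
by apply: payoff_le_blocks => // l; apply: le_trans (wc l); exact: nu_le_w.
Qed.

(** All but at most [m] of the stages [m], ..., [m + n - 1] are among the first
    [n] stages. *)
Lemma v_shift_le m n z : n%:R * v m n z <= n%:R * v 0 n z + m%:R.
Proof.
case: n => [|n]; first by rewrite !mul0r add0r.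
rewrite -ler_pdivlMl ?ltr0n //; apply: v_le => s Ss.
rewrite gamma_shift_le // mulrA divff ?pnatr_eq0 // mul1r.
have e1 := payoffD 0 m n.+1 s; have e2 := payoffD 0 n.+1 m s.
have := payoff_le (0 + n.+1) m s; have := payoff_ge0 0 m s.
have := payoff_le_v 0 n.+1 Ss.
rewrite addnC e2 !add0n in e1; lra.
Qed.

(** This lemma and the next one say that [w_mn F r m n z] is the supremum of
    [w_mn F r 0 n] over the states that can be reached from [z] at stage [m]. *)
Lemma nu_le_w_state z s m n : (0 < n)%N -> S z s ->
  nu r m n s <= w 0 n (state z s m).
Proof.
move=> n0 Ss; rewrite -{1}(addn0 m) -nu_shift.
by apply: nu_le_w => //; exact: plays_shift.
Qed.

Lemma w_state_le z s m n : (0 < n)%N -> S z s ->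
  w 0 n (state z s m) <= w m n z.
Proof.
move=> n0 Ss; apply: w_le => // s' Ss'.
have -> : nu r 0 n s' = nu r m n (splice m s s').
  rewrite -{1}(addn0 m) -nu_shift; congr nu.
  by apply/funext => t; rewrite spliceD.
by apply: nu_le_w => //; exact: plays_splice.
Qed.

(** * Consequences of total boundedness *)

(** The form in which total boundedness of the functions [w_mn] is used; it is
    derived from the metric formulation by [totally_bounded_cells]. *)
Hypothesis w_cells : forall e, 0 < e -> exists (T : finType) (rep : T -> Z),
  forall z, exists i, forall m n, (0 < n)%N -> `|w m n z - w m n (rep i)| <= e.

(** Each of the finitely many cells that can be visited from [z] can be visited
    at some stage; [M] is the largest of these stages. *)
Lemma w_reach_early z e : 0 < e -> exists M, forall m n, (0 < n)%N ->
  exists2 m', (m' <= M)%N & w m n z <= w m' n z + e.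
Proof.
move=> e0; have e30 : 0 < e / 3 by lra.
have [T [rep near_rep]] := w_cells e30.
pose hit i m := exists2 s, S z s & forall n, (0 < n)%N ->
  `|w 0 n (state z s m) - w 0 n (rep i)| <= e / 3.
have /choice[h hP] : forall i, exists m, forall m', hit i m' -> hit i m.
  move=> i; have [[m im]|no] := pselect (exists m, hit i m); first by exists m.
  by exists 0%N => m' im'; case: no; exists m'.
exists (\max_i h i)%N => m n n0.
have [s Ss ws] := w_near m z n0 e30.
have [i ni] := near_rep (state z s m).
have [|s' Ss' ns'] := hP i m; first by exists s => // k k0; exact: ni.
exists (h i); first exact: leq_bigmax.
have := nu_le_w_state m n0 Ss; have := w_state_le (h i) n0 Ss'.
have /ler_normlP[_] := ni 0%N n n0; have /ler_normlP[] := ns' n n0; lra.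
Qed.

(** The bound is made independent of [z] by taking the maximum over the
    representatives of the cells. *)
Lemma w_reach_early_unif e : 0 < e -> exists M, forall z m n, (0 < n)%N ->
  exists2 m', (m' <= M)%N & w m n z <= w m' n z + e.
Proof.
move=> e0; have e30 : 0 < e / 3 by lra.
have [T [rep near_rep]] := w_cells e30.
have /choice[M MP] := fun i => w_reach_early (rep i) e30.
exists (\max_i M i)%N => z m n n0; have [i ni] := near_rep z.
have [m' m'M le] := MP i m n n0.
exists m'; first by apply: leq_trans m'M _; exact: leq_bigmax.
have /ler_normlP[_] := ni m n n0; have /ler_normlP[] := ni m' n n0; lra.
Qed.

(** By [w_reach_early_unif], for each horizon some [m <= M] is good. If every
    [m <= M] failed at some horizon, then, the values being nonincreasing in the
    horizon, all of them would fail at the largest of these. *)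
Lemma V_guaranteed e : 0 < e -> exists M, forall z,
  exists2 m, (m <= M)%N & forall n, (0 < n)%N -> V z - e <= w m n z.
Proof.
move=> e0; have e20 : 0 < e / 2 by lra.
have [M MP] := w_reach_early_unif e20.
exists M => z; apply: contrapT => no.
have /choice[g gP] : forall m, exists n, (m <= M)%N ->
    (0 < n)%N /\ w m n z < V z - e.
  move=> m; apply: contrapT => /forallNP nn; apply: no; exists m.
    by apply: contrapT => mM; apply: (nn 0%N) => /mM.
  move=> n n0; rewrite leNgt; apply/negP => lt; exact: (nn n).
pose N := (\max_(i < M.+1) g i).+1.
have [m le] := V_near_ge z e20 (ltn0Sn _ : (0 < N)%N).
have [m' m'M le'] := MP z m N (ltn0Sn _).
have [g0 lt] := gP m' m'M.
have : w m' N z <= w m' (g m') z.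
  apply: w_anti => //; apply: leqW.
  have m'M1 : (m' < M.+1)%N by [].
  exact: (leq_bigmax (F := fun i : 'I_M.+1 => g i) (Ordinal m'M1)).
lra.
Qed.

(** Dini's argument: monotone convergence of functions that are nearly constant
    on finitely many cells is uniform. *)
Lemma w_le_V_unif e : 0 < e ->
  exists2 K, (0 < K)%N & forall z m, w m K z <= V z + e.
Proof.
move=> e0; have e50 : 0 < e / 5 by lra.
have [T [rep near_rep]] := w_cells e50.
have /choice[k kP] : forall i, exists k,
    (0 < k)%N /\ forall m, w m k (rep i) <= V (rep i) + e / 5.
  by move=> i; have [k k0 le] := V_near_le (rep i) e50; exists k.
exists (\max_i k i).+1 => // z m; have [i ni] := near_rep z.
have [k0 le] := kP i.
have [n n0 Vz] := V_near_le z e50; have [l Vi] := V_near_ge (rep i) e50 n0.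
have : w m (\max_i k i).+1 z <= w m (k i) z.
  by apply: w_anti => //; apply: leqW; exact: leq_bigmax.
have := Vz l; have := le m.
have /ler_normlP[_] := ni m (k i) k0; have /ler_normlP[] := ni l n n0; lra.
Qed.

Lemma natr_le_mul (M : nat) e : 0 < e -> exists N : nat,
  forall n, (N <= n)%N -> M%:R <= n%:R * e :> R.
Proof.
move=> e0; have [N NP] := exists_natr_ge (M%:R / e); exists N.+1 => n Nn.
by rewrite -ler_pdivrMr //; apply: le_trans NP _; rewrite ler_nat.
Qed.

Lemma v_le_V_unif e : 0 < e -> exists N, forall n, (N <= n)%N ->
  forall z m, v m n z <= V z + e.
Proof.
move=> e0; have e20 : 0 < e / 2 by lra.
have [K K0 KP] := w_le_V_unif e20.
have [N NP] := natr_le_mul K e20; exists N.+1 => n Nn z m.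
have n0 : 0 < n%:R :> R by rewrite ltr0n (leq_trans _ Nn).
have := v_le_blocks m n K0 (KP z); have := NP n (ltnW Nn) => Kn le.
by rewrite -(ler_pM2l n0); lra.
Qed.

Lemma V_le_v_unif e : 0 < e -> exists N, forall n, (N <= n)%N ->
  forall z, V z - e <= v 0 n z.
Proof.
move=> e0; have e20 : 0 < e / 2 by lra.
have [M MP] := V_guaranteed e20.
have [N NP] := natr_le_mul M e20; exists N.+1 => n Nn z.
have n0 : 0 < n%:R :> R by rewrite ltr0n (leq_trans _ Nn).
have [m mM Vm] := MP z.
have w_n : V z - e / 2 <= v m n z.
  have n0' : (0 < n)%N by rewrite (leq_trans _ Nn).
  exact: le_trans (Vm n n0') (w_le_v m z n0').
have mMR : m%:R <= M%:R :> R by rewrite ler_nat.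
have := NP n (ltnW Nn); have := v_shift_le m n z.
have : n%:R * (V z - e / 2) <= n%:R * v m n z by rewrite ler_pM2l.
by move=> *; rewrite -(ler_pM2l n0); lra.
Qed.

(** The play is taken good on a horizon [n + N] with [N] much larger than [n].
    Its last [N] stages then still average almost [V z - e], so the state at
    stage [m + n] has a large [N]-stage value, hence, by the uniform upper
    bound, a large [V]. *)
Lemma good_block e : 0 < e -> exists M, forall z,
  exists2 m, (m <= M)%N & forall n, exists s, [/\ S z s,
    forall t, (t <= n)%N -> t%:R * (V z - e) <= payoff m t s &
    V z - e <= V (state z s (m + n))].
Proof.
move=> e0; have e40 : 0 < e / 4 by lra.
have [M MP] := V_guaranteed e40; exists M => z.
have [m mM mP] := MP z; exists m => // n.
have [N0 N0P] := v_le_V_unif e40.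
have [N1 N1P] := natr_le_mul n e40.
pose N := (maxn N0 N1).+1.
have [|s Ss] := @w_near m (n + N) z _ _ e40; first by rewrite addnS.
have nN0 : (0 < n + N)%N by rewrite addnS.
set x := nu r m (n + N) s => le.
have Vx : V z - e / 2 <= x by have := mP (n + N)%N nN0; lra.
have pP t : (t <= n + N)%N -> t%:R * x <= payoff m t s.
  by move: (lexx x) => /nu_ge; apply.
exists s; split=> //.
  move=> t tn; apply: le_trans (pP t _); last exact: leq_trans (leq_addr _ _).
  by rewrite ler_wpM2l //; lra.
have N0' : 0 < N%:R :> R by rewrite ltr0n.
(* The first [n] stages are discarded: they earn at most [n], and
   [n * x >= 0]. *)
have nx0 : 0 <= n%:R * x by rewrite mulr_ge0 //; case/andP: (nu01 m s nN0).
have Nx : N%:R * (V z - e / 2) <= N%:R * x by rewrite ler_pM2l.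
have := pP _ (leqnn _); rewrite payoffD natrD mulrDl.
have := payoff_le m n s.
have := payoff_le_v 0 N (plays_shift (m + n) Ss).
rewrite payoff_shift addn0.
have := N1P N (leqW (leq_maxr _ _)).
have := N0P N (leqW (leq_maxl _ _)) (state z s (m + n)) 0%N.
by rewrite -(ler_pM2l N0') => *; rewrite -(ler_pM2l N0'); lra.
Qed.

(** * A play that is good in the long run *)

(** The deficit of a play at stage [t] is what it lacks to an average of
    [c = V z - d]. During the long stretch of a block it never exceeds its value
    at the start of that stretch, and the delay before the stretch increases it
    by at most the length of the delay, as [c <= 1]. So it suffices that at the
    start of block [i] the deficit plus the bound [M i] on the coming delay is
    at most [M 0 + L * d], with [L] the current stage: the stretch, chosen of
    length [n] with [M i.+1 <= n * d], restores this for the next block, and the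
    deficit at every stage [t] is at most [M 0 + t * d].

    In the invariant [P], the bound [c + q i] on [V] leaves room for the loss of
    [q i.+1] in block [i]. *)
Lemma good_play z e : 0 < e -> exists2 s, S z s &
  exists N, forall n, (N <= n)%N -> V z - e <= gamma r n s.
Proof.
move=> e0; pose d := e / 3; have d0 : 0 < d by rewrite /d; lra.
pose c := V z - d.
have c1 : c <= 1 by rewrite /c; case/andP: (V01 z); lra.
pose q i : R := d / 2 ^+ i.
have q0 i : 0 < q i by rewrite divr_gt0 // exprn_gt0.
have qS i : q i = q i.+1 + q i.+1 by rewrite /q exprS; field; rewrite expf_neq0.
have /choice[M MP] := fun i => good_block (q0 i.+1).
pose deficit t s := t%:R * c - payoff 0 t s.
pose P i (x : nat * (nat -> Z)) := [/\ S z x.2, c + q i <= V (state z x.2 x.1),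
  forall t, (t <= x.1)%N -> deficit t x.2 <= (M 0%N)%:R + t%:R * d &
  deficit x.1 x.2 + (M i)%:R <= (M 0%N)%:R + x.1%:R * d].
pose Q (x y : nat * (nat -> Z)) := (x.1 < y.1)%N /\
  forall t, (t < x.1)%N -> y.2 t = x.2 t.
have [||x xP] := @exists_seq _ P Q.
(* Before the first block, no stage has been played. *)
- have [s Ss] := plays_n0 z; exists (0%N, s); split=> //=.
  + by rewrite /c /q expr0 divr1 subrK.
  + move=> t; rewrite leqn0 => /eqP ->.
    by rewrite /deficit /payoff big_geq // !mul0r subr0 addr0.
  + by rewrite /deficit /payoff big_geq // !mul0r subr0 addr0 add0r.
- move=> i [L s] [/= Ss Vs Ds Ms].
  have [m mM mP] := MP i (state z s L).
  have [N NP] := natr_le_mul (M i.+1) d0.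
  have Mn := NP N.+1 (leqnSn _); set n := N.+1 in Mn.
  have [s' [Ss' pays' Vs']] := mP n.
  have qc : c + q i.+1 <= V (state z s L) - q i.+1 by rewrite qS in Vs; lra.
  have payL t : payoff 0 (L + t) (splice L s s') = payoff 0 L s + payoff 0 t s'.
    rewrite payoffD; congr (_ + _); apply: eq_payoff => k kL.
      by rewrite splice_lt.
    by rewrite add0n spliceD.
  have defL t : deficit (L + t) (splice L s s') = deficit L s + deficit t s'.
    by rewrite /deficit payL natrD; lra.
  have def_m t : (t <= m)%N -> deficit t s' <= (M i)%:R.
    move=> tm; apply: (@le_trans _ _ t%:R).
      rewrite /deficit; have := payoff_ge0 0 t s'.
      have : t%:R * c <= t%:R * 1 by rewrite ler_wpM2l.
      lra.
    by rewrite ler_nat (leq_trans tm).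
  have def_n t : (t <= n)%N -> deficit (m + t) s' <= (M i)%:R.
    move=> tn; have := def_m m (leqnn m); have := pays' t tn.
    have : t%:R * c <= t%:R * (V (state z s L) - q i.+1).
      by rewrite ler_wpM2l //; have := q0 i.+1; lra.
    rewrite /deficit payoffD natrD add0n; lra.
  exists (L + (m + n), splice L s s')%N; split; last first.
    split=> /= [|t tL]; last by rewrite splice_lt.
    by rewrite -addn1 leq_add2l addnS.
  split=> /=.
  + exact: plays_splice.
  + by rewrite state_spliceD; lra.
  + move=> t tL; case: (leqP t L) => [tL'|/ltnW Lt].
      rewrite /deficit (eq_payoff (s' := s) (m' := 0)) ?Ds // => k kt.
      by rewrite splice_lt // (leq_trans kt).
    rewrite -(subnKC Lt) defL; set t' := (t - L)%N.
    have : deficit t' s' <= (M i)%:R.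
      case: (leqP t' m) => [/def_m//|/ltnW mt].
      by rewrite -(subnKC mt) def_n // leq_subLR /t' leq_subLR.
    have : 0 <= t'%:R * d by rewrite mulr_ge0 // ltW.
    by rewrite natrD; lra.
  + have := def_n n (leqnn n); rewrite defL !natrD.
    have : 0 <= m%:R * d by rewrite mulr_ge0 // ltW.
    by lra.
have [] := @limit_play Z F z (fun i => (x i).1) (fun i => (x i).2).
- by move=> i; have [[]] := xP i.
- by move=> i; have [_ []] := xP i.
- by move=> i; have [_ []] := xP i.
move=> s [Ss sx]; exists s => //.
have [N NP] := natr_le_mul (M 0%N) d0; exists N.+1 => n Nn.
have n0 : (0 < n)%N by exact: leq_ltn_trans Nn.
have [i nL] : exists i, (n <= (x i).1)%N.
  exists n; elim: n {Nn n0} => // n IH; have [_ [lt _]] := xP n.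
  exact: leq_ltn_trans IH lt.
have [[_ _ Ds _] _] := xP i; have := Ds n nL.
rewrite /deficit (eq_payoff (s' := s) (m' := 0)); last first.
  by move=> t tn; rewrite !add0n (sx i) // (leq_trans tn).
have := NP n (ltnW Nn) => *.
change (V z - e <= gamma_shift r 0 n s); rewrite gamma_shift_ge //.
(* The third [d] pays for the delay [M 0] of the first block. *)
have : n%:R * (V z - e) = n%:R * c - n%:R * d - n%:R * d.
  by rewrite /c /d; field.
lra.
Qed.

(** * Equality of the values *)

Lemma v_cvg_unif e : 0 < e -> exists N, forall n, (N <= n)%N ->
  forall z, `|V z - v_n F r n z| <= e.
Proof.
move=> e0; have [N1 N1P] := v_le_V_unif e0; have [N2 N2P] := V_le_v_unif e0.
exists (maxn N1 N2) => n; rewrite geq_max => /andP[n1 n2] z.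
have := N1P n n1 z 0%N; have := N2P n n2 z.
have -> : v 0 n z = v_n F r n z by [].
by move=> *; apply/ler_normlP; split; lra.
Qed.

Lemma v_low_eq z : v_low F r z = V z.
Proof.
have g01 s n : 0 <= gamma r n s <= 1 by exact: (gamma_shift01 0 n s).
have linf01 s := limn_inf01_in (g01 s).
apply/eqP; rewrite eq_le; apply/andP; split.
  apply: (sup01_le (plays_n0 z)) => s Ss.
  apply/ler_addgt0Pr => e e0; apply: limn_inf_le => // N.
  have [N1 N1P] := v_le_V_unif e0.
  exists (maxn N N1); first exact: leq_maxl.
  apply: le_trans (N1P _ (leq_maxr _ _) z 0%N).
  exact: (gamma_le_v 0 _ Ss).
apply/ler_addgt0Pr => e e0; have [s Ss [N NP]] := good_play z e0.
rewrite -lerBlDr; apply: le_trans (le_sup01 linf01 Ss).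
exact: limn_inf_ge NP.
Qed.

Local Notation inf_v m z := (inf [set v m n z | n in [set n | (1 <= n)%N]]).
Local Notation inf_w m z := (inf [set w m n z | n in [set n | (1 <= n)%N]]).

Lemma inf_w_le_inf_v m z : inf_w m z <= inf_v m z.
Proof.
apply: inf01_ge; first by exists 1%N.
move=> n n0; apply: le_trans (w_le_v m z n0).
apply: ge_inf; last by exists n.
by exists 0 => _ [k k0 <-]; case/andP: (w01 m z k0).
Qed.

Lemma inf_v_le_V m z : inf_v m z <= V z.
Proof.
apply/ler_addgt0Pr => e e0; have [N NP] := v_le_V_unif e0.
apply: le_trans (NP N.+1 (leqnSn _) z m).
by apply: (ge_inf01 (v01 m ^~ z)).
Qed.

Lemma V_le_sup_inf_w z : V z <= sup [set inf_w m z | m in setT].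
Proof.
apply/ler_addgt0Pr => e e0; have [M MP] := V_guaranteed e0.
have [m _ mP] := MP z; rewrite -lerBlDr.
apply: (@le_trans _ _ (inf_w m z)).
  apply: lb_le_inf; first by apply: image_nonempty; exists 1%N.
  by move=> _ [n n0 <-]; exact: mP.
apply: ub_le_sup; last by exists m.
exists (V z) => _ [k _ <-].
exact: le_trans (inf_w_le_inf_v k z) (inf_v_le_V k z).
Qed.

Lemma sup_inf_eq z :
  sup [set inf_v m z | m in setT] = V z /\
  sup [set inf_w m z | m in setT] = V z.
Proof.
have vV : sup [set inf_v m z | m in setT] <= V z.
  apply: ge_sup; first by apply: image_nonempty; exists 0%N.
  by move=> _ [m _ <-]; exact: inf_v_le_V.
have wv : sup [set inf_w m z | m in setT] <=
    sup [set inf_v m z | m in setT].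
  apply: ge_sup; first by apply: image_nonempty; exists 0%N.
  move=> _ [m _ <-]; apply: le_trans (inf_w_le_inf_v m z) _.
  apply: ub_le_sup; last by exists m.
  by exists (V z) => _ [k _ <-]; exact: inf_v_le_V.
have Vw := V_le_sup_inf_w z.
by split; apply/eqP; rewrite eq_le; apply/andP; split=> //;
  [exact: le_trans Vw wv | exact: le_trans wv vV].
Qed.

End values.

(** * The theorem *)

Theorem theorem3p7 (R : realType) (Z : Type) (F : Z -> set Z) (r : Z -> R)
    (Z_nonempty : [set: Z] !=set0)
    (F_nonempty : forall z : Z, F z !=set0)
    (r_01 : forall z : Z, 0 <= r z <= 1)
    (W_precompact : totally_bounded (@d_infty R Z) (W_set F r)) :
  (forall z : Z,
     has_uniform_value F r z /\
     is_uniform_value F r z (v_star F r z) /\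
     v_star F r z = v_low F r z /\
     v_low F r z = v_plus F r z /\
     v_plus F r z = v_minus F r z /\
     v_minus F r z =
       sup [set inf [set v_mn F r m n z | n in [set n : nat | (1 <= n)%N]]
           | m in [set: nat]] /\
     sup [set inf [set v_mn F r m n z | n in [set n : nat | (1 <= n)%N]]
         | m in [set: nat]] =
       sup [set inf [set w_mn F r m n z | n in [set n : nat | (1 <= n)%N]]
           | m in [set: nat]]) /\
  converges_uniformly (v_n F r) (v_star F r).
Proof.
have W01 f : W_set F r f -> forall z, 0 <= f z <= 1.
  by move=> [m [n [n0 ->]]] z; exact: w01.
have cells e : 0 < e -> exists (T : finType) (rep : T -> Z),
    forall z, exists i, forall m n, (0 < n)%N ->
      `|w_mn F r m n z - w_mn F r m n (rep i)| <= e.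
  move=> e0.
  have [T [rep repP]] := totally_bounded_cells Z_nonempty W01 W_precompact e0.
  exists T, rep => z; have [i iP] := repP z; exists i => m n n0.
  by apply: iP; exists m, n.
have cvg := v_cvg_unif F_nonempty r_01 cells.
split=> [z|]; last exact: converges_uniformlyI.
have vz : v_n F r n z @[n --> \oo] --> v_star F r z.
  apply/cvgrPdist_le => e e0; have [N NP] := cvg e e0.
  by exists N => // n Nn; exact: NP.
rewrite /has_uniform_value /is_uniform_value /v_plus /v_minus.
rewrite !(cvg_limn_inf_sup vz) (v_low_eq F_nonempty r_01 cells z).
by have [-> ->] := sup_inf_eq F_nonempty r_01 cells z.
Qed.
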